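(* Let $A\in(0,1/3)$ and $s^*\in(2,\infty)$. Put $$d^*=\frac{-2+\sqrt{\left(3As^*\ln\left(\frac{s^*+2}{s^*-2}\right)-6A\right)^2+4-36A^2}}{3A\ln\left(\frac{s^*+2}{s^*-2}\right)},$$ and let $c^*$ be either of the two real numbers with $$|c^*|=\frac{4-d^{*2}}{4}\sqrt{\frac{(s^{*2}-4)(3Ad^*+s^* )}{s^{*2}-d^{*2}}}.$$ Then the Hamiltonian system defined in the context has a unique (up to the choice of the initial angle $\theta_0$) circular orbit with $s=s^*$ and $P_\theta=c^*$. Its radius is $r^*=\frac14\sqrt{(s^{*2}-4)(4-d^{*2})}$ and its period is $T=2\pi r^{*2}/|c^*|$.
   Context: For a parameter $A\in[0,1/3)$, consider on $\{r>0\}$, with coordinates $(r,\theta,x,P_r,P_\theta,P_x)$ ($r>0$ the distance to the $x$-axis, $\theta$ the polar angle around it), the Hamiltonian $$\mathcal H=\frac12\left(P_r^2+P_x^2+\frac{P_\theta^2}{r^2}\right)+3A\,d-\frac14(3A\,d\,s+4)\ln\left(\frac{s+2}{s-2}\right),$$ where $$s=\sqrt{(A+x-1)^2+r^2}+\sqrt{(A+x+1)^2+r^2},\qquad d=\sqrt{(A+x-1)^2+r^2}-\sqrt{(A+x+1)^2+r^2}.$$ Its equations of motion are $$\dot r=P_r,\quad \dot\theta=\frac{P_\theta}{r^2},\quad \dot x=P_x,\quad \dot P_\theta=0,$$ $$\dot P_r=\frac{P_\theta^2}{r^3}-\frac{16r(3Ad+s)}{(s^2-d^2)(s^2-4)},\qquad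 \dot P_x=\frac{4d+12As}{s^2-d^2}-3A\ln\left(\frac{s+2}{s-2}\right).$$ The pair $(r,x)$ with $r>0$ is recovered from $(s,d)\in(2,\infty)\times(-2,2)$ by $r=\frac14\sqrt{(s^2-4)(4-d^2)}$, $x=-A-\frac{ds}{4}$. A circular orbit is a solution with $r$ and $x$ constant in time (hence $P_r=P_x=0$ and $s,d$ constant) and $P_\theta\neq0$; its radius is the constant value of $r$, and its period is the time in which $\theta$ changes by $\pm2\pi$. *)

(* Defs.v *)
From Stdlib Require Import Reals Lra Psatz.
From Coquelicot Require Import Coquelicot.
Open Scope R_scope.

Record phase_point : Type := PhasePoint {
  q_r : R; q_theta : R; q_x : R;
  p_r : R; p_theta : R; p_x : R
}.

Definition s_coord (A r x : R) : R :=
  sqrt ((A + x - 1) ^ 2 + r ^ 2) + sqrt ((A + x + 1) ^ 2 + r ^ 2).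

Definition d_coord (A r x : R) : R :=
  sqrt ((A + x - 1) ^ 2 + r ^ 2) - sqrt ((A + x + 1) ^ 2 + r ^ 2).

Definition log_ratio (s : R) : R := ln ((s + 2) / (s - 2)).

Definition hamiltonian (A r theta x pr ptheta px : R) : R :=
  / 2 * (pr ^ 2 + px ^ 2 + ptheta ^ 2 / r ^ 2)
  + 3 * A * d_coord A r x
  - / 4 * (3 * A * d_coord A r x * s_coord A r x + 4)
      * log_ratio (s_coord A r x).

(* Hamilton's canonical equations, for all times, in the region r > 0.  The
   angle theta is a real-valued lift, so it is not reduced modulo 2 PI. *)
Definition is_solution (A : R) (g : R -> phase_point) : Prop :=
  forall t : R,
  let H := hamiltonian A in
  let r := q_r (g t) in let theta := q_theta (g t) in let x := q_x (g t) in
  let pr := p_r (g t) in let ptheta := p_theta (g t) in let px := p_x (g t) in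
  0 < r /\
  is_derive (fun u => q_r (g u)) t
    (Derive (fun p => H r theta x p ptheta px) pr) /\
  is_derive (fun u => q_theta (g u)) t
    (Derive (fun p => H r theta x pr p px) ptheta) /\
  is_derive (fun u => q_x (g u)) t
    (Derive (fun p => H r theta x pr ptheta p) px) /\
  is_derive (fun u => p_r (g u)) t
    (- Derive (fun q => H q theta x pr ptheta px) r) /\
  is_derive (fun u => p_theta (g u)) t
    (- Derive (fun q => H r q x pr ptheta px) theta) /\
  is_derive (fun u => p_x (g u)) t
    (- Derive (fun q => H r theta q pr ptheta px) x).

Definition has_radius (g : R -> phase_point) (rho : R) : Prop :=
  forall t : R, q_r (g t) = rho.

Definition is_circular_orbit (A : R) (g : R -> phase_point) : Prop :=
  is_solution A g /\
  (exists rho : R, has_radius g rho) /\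
  (exists x0 : R, forall t : R, q_x (g t) = x0) /\
  (forall t : R, p_theta (g t) <> 0).

Definition has_s_and_p_theta (A : R) (g : R -> phase_point) (s c : R) : Prop :=
  forall t : R, s_coord A (q_r (g t)) (q_x (g t)) = s /\ p_theta (g t) = c.

(* T is the first time after which theta has changed by +-2 PI, whatever the
   starting time t. *)
Definition is_period (g : R -> phase_point) (T : R) : Prop :=
  0 < T /\
  forall t : R,
    Rabs (q_theta (g (t + T)) - q_theta (g t)) = 2 * PI /\
    (forall u : R, 0 <= u < T ->
       Rabs (q_theta (g (t + u)) - q_theta (g t)) < 2 * PI).

Definition d_star (A s : R) : R :=
  (- 2 + sqrt ((3 * A * s * log_ratio s - 6 * A) ^ 2 + 4 - 36 * A ^ 2))
  / (3 * A * log_ratio s).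

Definition abs_c_star (A s : R) : R :=
  let d := d_star A s in
  (4 - d ^ 2) / 4
  * sqrt ((s ^ 2 - 4) * (3 * A * d + s) / (s ^ 2 - d ^ 2)).

Definition r_star (A s : R) : R :=
  / 4 * sqrt ((s ^ 2 - 4) * (4 - d_star A s ^ 2)).

(* The first-order partial derivatives of the Hamiltonian on r > 0: every
   [Derive] in [is_solution] is the value of a genuine derivative there. *)
Lemma is_derive_hamiltonian_pr (A r theta x pr ptheta px : R) :
  is_derive (fun p => hamiltonian A r theta x p ptheta px) pr pr.
Proof. unfold hamiltonian; auto_derive; [easy | field]. Qed.

Lemma is_derive_hamiltonian_ptheta (A r theta x pr ptheta px : R) :
  0 < r ->
  is_derive (fun p => hamiltonian A r theta x pr p px) ptheta (ptheta / r ^ 2).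
Proof. intros Hr; unfold hamiltonian; auto_derive; [easy | field; lra]. Qed.

Lemma is_derive_hamiltonian_px (A r theta x pr ptheta px : R) :
  is_derive (fun p => hamiltonian A r theta x pr ptheta p) px px.
Proof. unfold hamiltonian; auto_derive; [easy | field]. Qed.

Lemma is_derive_hamiltonian_theta (A r theta x pr ptheta px : R) :
  is_derive (fun q => hamiltonian A r q x pr ptheta px) theta 0.
Proof. unfold hamiltonian; auto_derive; [easy | reflexivity]. Qed.

Lemma Rabs_lt_sqrt_sum (a r : R) : 0 < r -> Rabs a < sqrt (a ^ 2 + r ^ 2).
Proof.
intros Hr; rewrite <- sqrt_Rsqr_abs; apply sqrt_lt_1_alt; unfold Rsqr.
assert (0 < r * r) by nra; pose proof (Rle_0_sqr a); unfold Rsqr in *.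
simpl; lra.
Qed.

Lemma s_coord_gt2 (A r x : R) : 0 < r -> 2 < s_coord A r x.
Proof.
intros Hr; unfold s_coord.
pose proof (Rabs_lt_sqrt_sum (A + x - 1) r Hr) as H1.
pose proof (Rabs_lt_sqrt_sum (A + x + 1) r Hr) as H2.
revert H1 H2; unfold Rabs; destruct (Rcase_abs (A + x - 1)), (Rcase_abs (A + x + 1)); lra.
Qed.

Lemma s2_sub_d2_gt0 (A r x : R) :
  0 < r -> 0 < s_coord A r x ^ 2 - d_coord A r x ^ 2.
Proof.
intros Hr; unfold s_coord, d_coord.
pose proof (Rabs_lt_sqrt_sum (A + x - 1) r Hr) as H1.
pose proof (Rabs_lt_sqrt_sum (A + x + 1) r Hr) as H2.
pose proof (Rabs_pos (A + x - 1)); pose proof (Rabs_pos (A + x + 1)); nra.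
Qed.

Lemma d_mul_s (A r x : R) : d_coord A r x * s_coord A r x = - 4 * (A + x).
Proof.
unfold s_coord, d_coord.
assert (H1 : 0 <= (A + x - 1) ^ 2 + r ^ 2)
  by (apply Rplus_le_le_0_compat; apply pow2_ge_0).
assert (H2 : 0 <= (A + x + 1) ^ 2 + r ^ 2)
  by (apply Rplus_le_le_0_compat; apply pow2_ge_0).
pose proof (sqrt_sqrt _ H1); pose proof (sqrt_sqrt _ H2); nra.
Qed.

Lemma is_derive_sqrt_sum_l (a r : R) :
  0 < r -> is_derive (fun q => sqrt (q ^ 2 + r ^ 2)) a (a / sqrt (a ^ 2 + r ^ 2)).
Proof.
intros Hr; pose proof (Rabs_lt_sqrt_sum a r Hr); pose proof (Rabs_pos a).
assert (0 < r * r) by nra; pose proof (Rle_0_sqr a); unfold Rsqr in *.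
auto_derive; [lra|].
replace (a * (a * 1) + r * (r * 1)) with (a ^ 2 + r ^ 2) by ring.
field; lra.
Qed.

Lemma is_derive_sqrt_sum_r (a r : R) :
  0 < r -> is_derive (fun q => sqrt (a ^ 2 + q ^ 2)) r (r / sqrt (a ^ 2 + r ^ 2)).
Proof.
intros Hr; apply is_derive_ext with (fun q => sqrt (q ^ 2 + a ^ 2)).
{ intros q; f_equal; ring. }
pose proof (Rabs_lt_sqrt_sum a r Hr); pose proof (Rabs_pos a).
assert (0 < r * r) by nra; pose proof (Rle_0_sqr a); unfold Rsqr in *.
auto_derive; [lra|].
replace (r * (r * 1) + a * (a * 1)) with (a ^ 2 + r ^ 2) by ring.
field; lra.
Qed.

Lemma is_derive_s_coord_r (A r x : R) : 0 < r ->
  is_derive (fun q => s_coord A q x) r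
    (4 * r * s_coord A r x / (s_coord A r x ^ 2 - d_coord A r x ^ 2)).
Proof.
intros Hr; pose proof (s2_sub_d2_gt0 A r x Hr) as Hsd.
evar_last.
{ apply @is_derive_plus; apply is_derive_sqrt_sum_r, Hr. }
unfold s_coord, d_coord in *.
pose proof (Rabs_lt_sqrt_sum (A + x - 1) r Hr).
pose proof (Rabs_lt_sqrt_sum (A + x + 1) r Hr).
pose proof (Rabs_pos (A + x - 1)); pose proof (Rabs_pos (A + x + 1)).
set (R1 := sqrt ((A + x - 1) ^ 2 + r ^ 2)) in *.
set (R2 := sqrt ((A + x + 1) ^ 2 + r ^ 2)) in *.
unfold plus; simpl; field; repeat split; nra.
Qed.

Lemma is_derive_d_coord_r (A r x : R) : 0 < r ->
  is_derive (fun q => d_coord A q x) r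
    (- 4 * r * d_coord A r x / (s_coord A r x ^ 2 - d_coord A r x ^ 2)).
Proof.
intros Hr; pose proof (s2_sub_d2_gt0 A r x Hr) as Hsd.
evar_last.
{ apply @is_derive_minus; apply is_derive_sqrt_sum_r, Hr. }
unfold s_coord, d_coord in *.
pose proof (Rabs_lt_sqrt_sum (A + x - 1) r Hr).
pose proof (Rabs_lt_sqrt_sum (A + x + 1) r Hr).
pose proof (Rabs_pos (A + x - 1)); pose proof (Rabs_pos (A + x + 1)).
set (R1 := sqrt ((A + x - 1) ^ 2 + r ^ 2)) in *.
set (R2 := sqrt ((A + x + 1) ^ 2 + r ^ 2)) in *.
unfold minus, plus, opp; simpl; field; repeat split; nra.
Qed.

Lemma is_derive_s_coord_x (A r x : R) : 0 < r ->
  is_derive (fun q => s_coord A r q) x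
    (d_coord A r x * (4 - s_coord A r x ^ 2)
     / (s_coord A r x ^ 2 - d_coord A r x ^ 2)).
Proof.
intros Hr; pose proof (s2_sub_d2_gt0 A r x Hr) as Hsd.
pose proof (d_mul_s A r x) as Hm.
evar_last.
{ apply @is_derive_plus;
    (eapply (@is_derive_comp _ R_NormedModule (fun q => sqrt (q ^ 2 + r ^ 2)));
     [apply is_derive_sqrt_sum_l, Hr
     | auto_derive; [easy | reflexivity]]). }
pose proof (Rabs_lt_sqrt_sum (A + x - 1) r Hr).
pose proof (Rabs_lt_sqrt_sum (A + x + 1) r Hr).
pose proof (Rabs_pos (A + x - 1)); pose proof (Rabs_pos (A + x + 1)).
set (a := A + x) in *.
unfold s_coord, d_coord in *; fold a in Hm, Hsd |- *.
set (R1 := sqrt ((a - 1) ^ 2 + r ^ 2)) in *.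
set (R2 := sqrt ((a + 1) ^ 2 + r ^ 2)) in *.
replace a with (- (R1 - R2) * (R1 + R2) / 4) by lra.
unfold plus, scal; simpl; unfold mult; simpl; field; repeat split; nra.
Qed.

Lemma is_derive_d_coord_x (A r x : R) : 0 < r ->
  is_derive (fun q => d_coord A r q) x
    (s_coord A r x * (d_coord A r x ^ 2 - 4)
     / (s_coord A r x ^ 2 - d_coord A r x ^ 2)).
Proof.
intros Hr; pose proof (s2_sub_d2_gt0 A r x Hr) as Hsd.
pose proof (d_mul_s A r x) as Hm.
evar_last.
{ apply @is_derive_minus;
    (eapply (@is_derive_comp _ R_NormedModule (fun q => sqrt (q ^ 2 + r ^ 2)));
     [apply is_derive_sqrt_sum_l, Hr
     | auto_derive; [easy | reflexivity]]). }
pose proof (Rabs_lt_sqrt_sum (A + x - 1) r Hr).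
pose proof (Rabs_lt_sqrt_sum (A + x + 1) r Hr).
pose proof (Rabs_pos (A + x - 1)); pose proof (Rabs_pos (A + x + 1)).
set (a := A + x) in *.
unfold s_coord, d_coord in *; fold a in Hm, Hsd |- *.
set (R1 := sqrt ((a - 1) ^ 2 + r ^ 2)) in *.
set (R2 := sqrt ((a + 1) ^ 2 + r ^ 2)) in *.
replace a with (- (R1 - R2) * (R1 + R2) / 4) by lra.
unfold minus, opp, plus, scal; simpl; unfold mult; simpl; field; repeat split; nra.
Qed.

Lemma is_derive_hamiltonian_r (A r theta x pr ptheta px : R) :
  let s := s_coord A r x in let d := d_coord A r x in
  0 < r ->
  is_derive (fun q => hamiltonian A q theta x pr ptheta px) r
    (16 * r * (3 * A * d + s) / ((s ^ 2 - d ^ 2) * (s ^ 2 - 4))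
     - ptheta ^ 2 / r ^ 3).
Proof.
intros s d Hr.
pose proof (s_coord_gt2 A r x Hr) as Hs.
pose proof (s2_sub_d2_gt0 A r x Hr) as Hsd.
pose proof (is_derive_s_coord_r A r x Hr) as Ds.
pose proof (is_derive_d_coord_r A r x Hr) as Dd.
fold s in Hs, Hsd, Ds, Dd; fold d in Hsd, Ds, Dd.
unfold hamiltonian, log_ratio; auto_derive; fold s d.
- repeat split; try lra; try (eexists; eassumption).
  + nra.
  + apply Rmult_lt_0_compat; [|apply Rinv_0_lt_compat]; lra.
- change (s + - (2)) with (s - 2); change (ln _) with (log_ratio s).
  set (L := log_ratio s).
  assert (Es : Derive (fun y : R => s_coord A y x) r = _)
    by (apply is_derive_unique; exact Ds).
  assert (Ed : Derive (fun y : R => d_coord A y x) r = _)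
    by (apply is_derive_unique; exact Dd).
  rewrite Es, Ed; clear Es Ed Ds Dd.
  field; repeat split; nra.
Qed.

Lemma is_derive_hamiltonian_x (A r theta x pr ptheta px : R) :
  let s := s_coord A r x in let d := d_coord A r x in
  0 < r ->
  is_derive (fun q => hamiltonian A r theta q pr ptheta px) x
    (3 * A * log_ratio s - (4 * d + 12 * A * s) / (s ^ 2 - d ^ 2)).
Proof.
intros s d Hr.
pose proof (s_coord_gt2 A r x Hr) as Hs.
pose proof (s2_sub_d2_gt0 A r x Hr) as Hsd.
pose proof (is_derive_s_coord_x A r x Hr) as Ds.
pose proof (is_derive_d_coord_x A r x Hr) as Dd.
fold s in Hs, Hsd, Ds, Dd; fold d in Hsd, Ds, Dd.
unfold hamiltonian, log_ratio; auto_derive; fold s d.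
- repeat split; try lra; try (eexists; eassumption).
  apply Rmult_lt_0_compat; [|apply Rinv_0_lt_compat]; lra.
- change (s + - (2)) with (s - 2); change (ln _) with (log_ratio s).
  set (L := log_ratio s).
  assert (Es : Derive (fun y : R => s_coord A r y) x = _)
    by (apply is_derive_unique; exact Ds).
  assert (Ed : Derive (fun y : R => d_coord A r y) x = _)
    by (apply is_derive_unique; exact Dd).
  rewrite Es, Ed; clear Es Ed Ds Dd.
  field; repeat split; nra.
Qed.

(* Main.v *)
Require Import Defs.
From Stdlib Require Import Reals Lra Psatz.
From Coquelicot Require Import Coquelicot.
Open Scope R_scope.

(** On a circular orbit [P_x = 0] for all times, so [dP_x/dt = 0], which is the
    quadratic equation [3 A L (s^2 - d^2) = 4 d + 12 A s] for [d], where
    [L = ln ((s + 2) / (s - 2))].  The bounds [4 / (s + 2) < L < 4 / (s - 2)]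
    and [A < 1 / 3] show that the quadratic changes sign between [d = -2] and
    [d = 2], so its larger root [d_star] is the only one in [(-2, 2)].  Hence
    [r] and [x] are determined by [s]; then [dP_r/dt = 0] is the condition on
    [|P_theta|], and [theta] is affine in [t] with slope [P_theta / r^2]. *)

(** * Bounds on the logarithm *)

(** The inequality [1 + u < exp u] at [u = ln y] and at [u = - ln y], where [y = (s + 2) / (s - 2)],
    gives [1 - 1 / y < ln y < y - 1]. *)
Lemma log_ratio_bounds (s : R) :
  2 < s -> 4 / (s + 2) < log_ratio s < 4 / (s - 2).
Proof.
intros Hs; unfold log_ratio.
set (y := (s + 2) / (s - 2)).
assert (Ey : y = 1 + 4 / (s - 2)) by (unfold y; field; lra).
assert (Ev : / y = 1 - 4 / (s + 2)) by (unfold y; field; lra).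
assert (H4 : 0 < 4 / (s - 2)) by (apply Rdiv_lt_0_compat; lra).
assert (Hy : 0 < y) by lra.
assert (HL : 0 < ln y) by (rewrite <- ln_1; apply ln_increasing; lra).
assert (H1 : 1 + ln y < exp (ln y)) by (apply exp_ineq1; lra).
assert (H2 : 1 + - ln y < exp (- ln y)) by (apply exp_ineq1; lra).
rewrite exp_Ropp in H2; rewrite exp_ln in H1, H2 by exact Hy.
lra.
Qed.

Lemma log_ratio_pos (s : R) : 2 < s -> 0 < log_ratio s.
Proof.
intros Hs; destruct (log_ratio_bounds s Hs) as [H _].
assert (0 < 4 / (s + 2)) by (apply Rdiv_lt_0_compat; lra); lra.
Qed.

(** * The equilibrium quadratic in [d] *)

(** This is [-(s^2 - d^2)] times the right-hand side of the equation for [P_x], which makes it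
    polynomial in [d]. *)
Definition balance (A s d : R) : R :=
  3 * A * log_ratio s * (s ^ 2 - d ^ 2) - (4 * d + 12 * A * s).

(** The lower bound on the logarithm, multiplied by [3 A (s^2 - 4)], leaves more than [8 - 24 A],
    which is positive. *)
Lemma balance_m2_pos (A s : R) :
  0 < A < 1 / 3 -> 2 < s -> 0 < balance A s (-2).
Proof.
intros HA Hs; destruct (log_ratio_bounds s Hs) as [H _].
apply Rlt_div_l in H; [|lra].
assert (0 < A * (s - 2) * (log_ratio s * (s + 2) - 4))
  by (repeat apply Rmult_lt_0_compat; lra).
unfold balance; nra.
Qed.

(** Symmetrically, the upper bound leaves less than [24 A - 8]. *)
Lemma balance_2_neg (A s : R) :
  0 < A < 1 / 3 -> 2 < s -> balance A s 2 < 0.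
Proof.
intros HA Hs; destruct (log_ratio_bounds s Hs) as [_ H].
apply Rlt_div_r in H; [|lra].
assert (0 < A * (s + 2) * (4 - log_ratio s * (s - 2)))
  by (repeat apply Rmult_lt_0_compat; lra).
unfold balance; nra.
Qed.

Lemma balance_d_star (A s : R) :
  0 < A < 1 / 3 -> 2 < s -> balance A s (d_star A s) = 0.
Proof.
intros HA Hs; pose proof (log_ratio_pos s Hs) as HL.
unfold balance, d_star; set (L := log_ratio s) in *.
assert (HD : 0 <= (3 * A * s * L - 6 * A) ^ 2 + 4 - 36 * A ^ 2)
  by (pose proof (pow2_ge_0 (3 * A * s * L - 6 * A)); nra).
pose proof (sqrt_sqrt _ HD) as HS.
set (q := sqrt _) in *.
assert (HAL : 0 < 3 * A * L) by (apply Rmult_lt_0_compat; lra).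
(* Since [3 A L d + 2 = q], completing the square turns [3 A L] times the quadratic into the
   radicand minus [q^2]. *)
replace (3 * A * L * _ - _) with
  (((3 * A * s * L - 6 * A) ^ 2 + 4 - 36 * A ^ 2 - q * q) / (3 * A * L))
  by (field; lra).
rewrite HS; field; lra.
Qed.

Lemma d_star_bounds (A s : R) :
  0 < A < 1 / 3 -> 2 < s -> -2 < d_star A s < 2.
Proof.
intros HA Hs; pose proof (log_ratio_pos s Hs) as HL.
pose proof (balance_m2_pos A s HA Hs) as Hm.
pose proof (balance_2_neg A s HA Hs) as Hp.
pose proof (balance_d_star A s HA Hs) as H0.
(* [d_star] is the larger root: it lies to the right of the vertex. *)
assert (Hv : 0 < 3 * A * log_ratio s * d_star A s + 2).
{ unfold d_star; set (q := sqrt _).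
  assert (Hq : 0 < q).
  { apply sqrt_lt_R0.
    pose proof (pow2_ge_0 (3 * A * s * log_ratio s - 6 * A)); nra. }
  replace (_ + 2) with q; [exact Hq | field; split; lra]. }
unfold balance in *; set (d := d_star A s) in *.
set (k := 3 * A * log_ratio s) in *.
assert (Hk : 0 < k) by (apply Rmult_lt_0_compat; lra).
split.
(* The product is the value at [-2] minus the value at [d]. If [d <= -2], then [Hv] gives [k d > -2]
   and [2 k < 2], so the second factor is positive and the product is not. *)
- assert (0 < (d + 2) * (k * (d - 2) + 4)) by nra.
  apply Rnot_le_lt; intros Hd.
  assert (k * (d - 2) + 4 < 0) by nra.
  nra.
(* Likewise the value at [d] minus the value at [2]. *)
- assert (0 < (2 - d) * (k * (d + 2) + 4)) by nra.
  apply Rnot_le_lt; intros Hd; nra.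
Qed.

Lemma balance_unique (A s d d' : R) :
  0 < A < 1 / 3 -> 2 < s -> -2 < d < 2 -> -2 < d' < 2 ->
  balance A s d = 0 -> balance A s d' = 0 -> d = d'.
Proof.
intros HA Hs Hd Hd' H H'; pose proof (log_ratio_pos s Hs) as HL.
pose proof (balance_m2_pos A s HA Hs) as Hm.
unfold balance in *; set (k := 3 * A * log_ratio s) in *.
assert (Hk : 0 < k) by (apply Rmult_lt_0_compat; lra).
(* Concavity: the slope between [-2] and [d] is negative, and steeper further right. *)
assert (0 < (d + 2) * (k * (d - 2) + 4)) by nra.
assert (0 < k * (d - 2) + 4) by nra.
(* The difference of the two values factors; the second factor exceeds [k (d - 2) + 4 > 0] because
   [d' > -2]. *)
assert (E : (d - d') * (k * (d + d') + 4) = 0) by nra.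
apply Rmult_integral in E; destruct E; nra.
Qed.

(** * Passing between [(r, x)] and [(s, d)] *)

(** The right side expands to [4 (s^2 + d^2) - (d s)^2 - 16], and both [s^2 + d^2] and [d s] are
    polynomials in [r] and [A + x]. *)
Lemma r_sq_of_s_d (A r x : R) :
  16 * r ^ 2 = (s_coord A r x ^ 2 - 4) * (4 - d_coord A r x ^ 2).
Proof.
pose proof (d_mul_s A r x) as Hm.
assert (Hp : s_coord A r x ^ 2 + d_coord A r x ^ 2
             = 4 * ((A + x) ^ 2 + 1 + r ^ 2)).
{ unfold s_coord, d_coord.
  assert (H1 : 0 <= (A + x - 1) ^ 2 + r ^ 2)
    by (apply Rplus_le_le_0_compat; apply pow2_ge_0).
  assert (H2 : 0 <= (A + x + 1) ^ 2 + r ^ 2)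
    by (apply Rplus_le_le_0_compat; apply pow2_ge_0).
  pose proof (sqrt_sqrt _ H1); pose proof (sqrt_sqrt _ H2); nra. }
transitivity (4 * (s_coord A r x ^ 2 + d_coord A r x ^ 2)
  - (d_coord A r x * s_coord A r x) ^ 2 - 16); [rewrite Hp, Hm|]; ring.
Qed.

Lemma d_coord_bounds (A r x : R) : 0 < r -> -2 < d_coord A r x < 2.
Proof.
intros Hr; pose proof (s_coord_gt2 A r x Hr).
pose proof (r_sq_of_s_d A r x).
assert (0 < r ^ 2) by (apply pow_lt, Hr).
assert (0 < s_coord A r x ^ 2 - 4) by nra.
assert (0 < 4 - d_coord A r x ^ 2) by nra.
nra.
Qed.

Lemma r_of_s_d (A r x : R) :
  0 < r ->
  r = / 4 * sqrt ((s_coord A r x ^ 2 - 4) * (4 - d_coord A r x ^ 2)).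
Proof.
intros Hr; rewrite <- r_sq_of_s_d.
replace (16 * r ^ 2) with ((4 * r) ^ 2) by ring.
rewrite sqrt_pow2 by lra; field.
Qed.

(** Converse direction: the point built from [(s, d)] has distances [(s + d) / 2] and [(s - d) / 2]
    to the two centres, since both radicands become perfect squares. *)
Lemma sqrt_bipolar (A s d : R) :
  2 < s -> -2 < d < 2 ->
  let r := / 4 * sqrt ((s ^ 2 - 4) * (4 - d ^ 2)) in
  let x := - A - d * s / 4 in
  sqrt ((A + x - 1) ^ 2 + r ^ 2) = (s + d) / 2 /\
  sqrt ((A + x + 1) ^ 2 + r ^ 2) = (s - d) / 2.
Proof.
intros Hs Hd r x.
assert (Hr : r ^ 2 = (s ^ 2 - 4) * (4 - d ^ 2) / 16).
{ unfold r; rewrite Rpow_mult_distr, pow2_sqrt; [field|].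
  apply Rmult_le_pos; nra. }
rewrite Hr; unfold x; split.
- rewrite <- (sqrt_pow2 ((s + d) / 2)) by lra; f_equal; field.
- rewrite <- (sqrt_pow2 ((s - d) / 2)) by lra; f_equal; field.
Qed.

(** * Positivity and the radial force balance *)

Lemma r_star_pos (A s : R) : 0 < A < 1 / 3 -> 2 < s -> 0 < r_star A s.
Proof.
intros HA Hs; pose proof (d_star_bounds A s HA Hs).
unfold r_star; apply Rmult_lt_0_compat; [lra|].
apply sqrt_lt_R0; apply Rmult_lt_0_compat; nra.
Qed.

Lemma abs_c_star_pos (A s : R) : 0 < A < 1 / 3 -> 2 < s -> 0 < abs_c_star A s.
Proof.
intros HA Hs; pose proof (d_star_bounds A s HA Hs).
unfold abs_c_star; set (d := d_star A s) in *.
apply Rmult_lt_0_compat; [nra|].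
(* [3 A d + s > 0] because [3 A < 1] and [|d| < 2 < s]. *)
apply sqrt_lt_R0, Rdiv_lt_0_compat; [apply Rmult_lt_0_compat|]; nra.
Qed.

Lemma abs_c_star_radial_balance (A s : R) :
  0 < A < 1 / 3 -> 2 < s ->
  16 * r_star A s * (3 * A * d_star A s + s)
    / ((s ^ 2 - d_star A s ^ 2) * (s ^ 2 - 4))
  = abs_c_star A s ^ 2 / r_star A s ^ 3.
Proof.
intros HA Hs; pose proof (d_star_bounds A s HA Hs).
pose proof (r_star_pos A s HA Hs) as Hr.
assert (Er : r_star A s ^ 2 = (s ^ 2 - 4) * (4 - d_star A s ^ 2) / 16).
{ unfold r_star; rewrite Rpow_mult_distr, pow2_sqrt; [field|].
  apply Rmult_le_pos; nra. }
unfold abs_c_star; set (d := d_star A s) in *; set (r := r_star A s) in *.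
assert (0 < s ^ 2 - 4) by nra.
assert (0 < s ^ 2 - d ^ 2) by nra.
rewrite Rpow_mult_distr, pow2_sqrt.
2: { apply Rlt_le, Rdiv_lt_0_compat; [apply Rmult_lt_0_compat|]; nra. }
(* After multiplication by [r^3] only [r^4 = (r^2)^2] remains, which [Er] makes polynomial in [s]
   and [d]. *)
apply Rmult_eq_reg_r with (r ^ 3); [|apply pow_nonzero; lra].
replace (_ / r ^ 3 * r ^ 3) with
  (((4 - d ^ 2) / 4) ^ 2 * ((s ^ 2 - 4) * (3 * A * d + s) / (s ^ 2 - d ^ 2)))
  by (field; lra).
replace (_ * r ^ 3) with
  (16 * (r ^ 2) ^ 2 * (3 * A * d + s) / ((s ^ 2 - d ^ 2) * (s ^ 2 - 4)))
  by (field; lra).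
rewrite Er; field; lra.
Qed.

(** * The explicit circular orbit *)

Definition circular_flow (A s c theta0 t : R) : phase_point :=
  PhasePoint (r_star A s) (theta0 + c / r_star A s ^ 2 * t)
    (- A - d_star A s * s / 4) 0 c 0.

Lemma circular_flow_s_d (A s : R) :
  0 < A < 1 / 3 -> 2 < s ->
  s_coord A (r_star A s) (- A - d_star A s * s / 4) = s /\
  d_coord A (r_star A s) (- A - d_star A s * s / 4) = d_star A s.
Proof.
intros HA Hs.
destruct (sqrt_bipolar A s (d_star A s) Hs (d_star_bounds A s HA Hs)) as [H1 H2].
unfold s_coord, d_coord, r_star; rewrite H1, H2; lra.
Qed.

Lemma is_derive_const_0 (a t : R) : is_derive (fun _ : R => a) t 0.
Proof. exact (is_derive_const a t). Qed.

Lemma circular_flow_is_solution (A s c theta0 : R) :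
  0 < A < 1 / 3 -> 2 < s -> Rabs c = abs_c_star A s ->
  is_solution A (circular_flow A s c theta0).
Proof.
intros HA Hs Hc t.
pose proof (r_star_pos A s HA Hs) as Hr.
pose proof (d_star_bounds A s HA Hs) as Hd.
destruct (circular_flow_s_d A s HA Hs) as [Es Ed].
cbn -[pow].
split; [|split; [|split; [|split; [|split; [|split]]]]].
- exact Hr.
- rewrite (is_derive_unique _ _ _ (is_derive_hamiltonian_pr _ _ _ _ _ _ _)).
  apply is_derive_const_0.
- rewrite (is_derive_unique _ _ _ (is_derive_hamiltonian_ptheta _ _ _ _ _ _ _ Hr)).
  auto_derive; [easy | field; lra].
- rewrite (is_derive_unique _ _ _ (is_derive_hamiltonian_px _ _ _ _ _ _ _)).
  apply is_derive_const_0.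
- rewrite (is_derive_unique _ _ _ (is_derive_hamiltonian_r _ _ _ _ _ _ _ Hr)).
  rewrite Es, Ed, (abs_c_star_radial_balance A s HA Hs), <- Hc, pow2_abs.
  evar_last; [apply is_derive_const_0 | ring].
- rewrite (is_derive_unique _ _ _ (is_derive_hamiltonian_theta _ _ _ _ _ _ _)).
  evar_last; [apply is_derive_const_0 | ring].
- rewrite (is_derive_unique _ _ _ (is_derive_hamiltonian_x _ _ _ _ _ _ _ Hr)).
  rewrite Es, Ed.
  pose proof (balance_d_star A s HA Hs) as Hb; unfold balance in Hb.
  evar_last; [apply is_derive_const_0|].
  replace (4 * d_star A s + 12 * A * s)
    with (3 * A * log_ratio s * (s ^ 2 - d_star A s ^ 2)) by lra.
  field; nra.
Qed.

Lemma circular_flow_is_circular_orbit (A s c theta0 : R) :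
  0 < A < 1 / 3 -> 2 < s -> Rabs c = abs_c_star A s ->
  is_circular_orbit A (circular_flow A s c theta0).
Proof.
intros HA Hs Hc; split; [|split; [|split]].
- now apply circular_flow_is_solution.
- now exists (r_star A s).
- now exists (- A - d_star A s * s / 4).
- intros t; cbn; intros ->.
  pose proof (abs_c_star_pos A s HA Hs); rewrite Rabs_R0 in Hc; lra.
Qed.

(** * Uniqueness of the orbit *)

Lemma is_derive_0_const (f : R -> R) :
  (forall t, is_derive f t 0) -> forall t, f t = f 0.
Proof.
intros H t; destruct (Rtotal_order t 0) as [Ht | [-> | Ht]].
- apply eq_is_derive; [intros u _; apply H | exact Ht].
- reflexivity.
- symmetry; apply eq_is_derive; [intros u _; apply H | exact Ht].
Qed.

(** Turns the constancy of a component into the vanishing of the right-hand side of its equation of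
    motion. *)
Lemma is_derive_of_const (f : R -> R) (a t l : R) :
  (forall u, f u = a) -> is_derive f t l -> l = 0.
Proof.
intros Hf Hl; rewrite <- (is_derive_unique _ _ _ Hl).
rewrite (Derive_ext _ _ _ Hf); apply Derive_const.
Qed.

Lemma circular_orbit_eq_flow (A s c : R) (g : R -> phase_point) :
  0 < A < 1 / 3 -> 2 < s ->
  is_circular_orbit A g -> has_s_and_p_theta A g s c ->
  forall t, g t = circular_flow A s c (q_theta (g 0)) t.
Proof.
intros HA Hs (Hsol & [rho Hrho] & [x0 Hx0] & _) Hsc.
assert (Hr0 : 0 < rho) by (rewrite <- (Hrho 0); apply (Hsol 0)).
assert (Hpr : forall t, p_r (g t) = 0).
{ intros t; destruct (Hsol t) as (_ & H & _).
  rewrite (is_derive_unique _ _ _ (is_derive_hamiltonian_pr _ _ _ _ _ _ _)) in H.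
  exact (is_derive_of_const _ rho _ _ Hrho H). }
assert (Hpx : forall t, p_x (g t) = 0).
{ intros t; destruct (Hsol t) as (_ & _ & _ & H & _).
  rewrite (is_derive_unique _ _ _ (is_derive_hamiltonian_px _ _ _ _ _ _ _)) in H.
  exact (is_derive_of_const _ x0 _ _ Hx0 H). }
assert (Es : s_coord A rho x0 = s)
  by (rewrite <- (Hrho 0), <- (Hx0 0); apply Hsc).
assert (Ed : d_coord A rho x0 = d_star A s).
{ apply (balance_unique A s); try assumption.
  - now apply d_coord_bounds.
  - now apply d_star_bounds.
  - destruct (Hsol 0) as (_ & _ & _ & _ & _ & _ & H).
    cbv zeta in H; rewrite Hrho, Hx0 in H.
    rewrite (is_derive_unique _ _ _ (is_derive_hamiltonian_x _ _ _ _ _ _ _ Hr0)) in H.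
    apply (is_derive_of_const _ 0 _ _ Hpx) in H.
    pose proof (s2_sub_d2_gt0 A rho x0 Hr0) as Hsd.
    rewrite Es in H, Hsd; set (d := d_coord A rho x0) in *.
    unfold balance.
    replace (3 * A * log_ratio s)
      with ((4 * d + 12 * A * s) / (s ^ 2 - d ^ 2)) by lra.
    field; lra.
  - now apply balance_d_star. }
assert (Er : rho = r_star A s)
  by (rewrite (r_of_s_d A rho x0 Hr0), Es, Ed; reflexivity).
assert (Ex : x0 = - A - d_star A s * s / 4)
  by (pose proof (d_mul_s A rho x0) as H; rewrite Es, Ed in H; lra).
assert (Hth : forall t, q_theta (g t) = q_theta (g 0) + c / r_star A s ^ 2 * t).
{ intros t.
  (* Subtracting the expected uniform rotation leaves a function with zero derivative. *)
  assert (H : forall u,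
    is_derive (fun v => q_theta (g v) - c / r_star A s ^ 2 * v) u 0).
  { intros u; destruct (Hsol u) as (Hr & _ & H & _).
    rewrite (is_derive_unique _ _ _ (is_derive_hamiltonian_ptheta _ _ _ _ _ _ _ Hr)) in H.
    rewrite (proj2 (Hsc u)), Hrho, Er in H.
    evar_last.
    { apply @is_derive_minus; [exact H|].
      apply is_derive_scal, is_derive_id. }
    unfold minus, plus, opp, mult, one; simpl; ring. }
  pose proof (is_derive_0_const _ H t) as E; cbv beta in E; lra. }
intros t; unfold circular_flow.
rewrite <- Hth, <- Ex, <- Er, <- (Hrho t), <- (Hx0 t), <- (proj2 (Hsc t)).
pose proof (Hpr t) as H1; pose proof (Hpx t) as H2.
destruct (g t); simpl in *; now subst.
Qed.

(** * The period *)

Lemma circular_flow_is_period (A s c theta0 : R) :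
  0 < r_star A s -> c <> 0 ->
  is_period (circular_flow A s c theta0) (2 * PI * r_star A s ^ 2 / Rabs c).
Proof.
intros Hr Hc; pose proof (Rabs_pos_lt c Hc) as Hc'; pose proof PI_RGT_0 as HPI.
set (T := 2 * PI * r_star A s ^ 2 / Rabs c).
assert (Hr2 : 0 < r_star A s ^ 2) by (apply pow_lt, Hr).
assert (HT : 0 < T)
  by (apply Rdiv_lt_0_compat; [apply Rmult_lt_0_compat; lra | exact Hc']).
assert (Hw : 0 < Rabs c / r_star A s ^ 2) by (apply Rdiv_lt_0_compat; lra).
assert (HwT : Rabs c / r_star A s ^ 2 * T = 2 * PI) by (unfold T; field; lra).
(* The swept angle is linear in the elapsed time with positive slope, so it stays below [2 PI] until
   exactly [T]. *)
assert (Hinc : forall t u, 0 <= u ->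
  Rabs (q_theta (circular_flow A s c theta0 (t + u))
        - q_theta (circular_flow A s c theta0 t)) = Rabs c / r_star A s ^ 2 * u).
{ intros t u Hu; unfold circular_flow, q_theta.
  replace (_ - _) with (c / r_star A s ^ 2 * u) by ring.
  rewrite Rabs_mult, Rabs_div by lra.
  rewrite (Rabs_pos_eq u), (Rabs_pos_eq (r_star A s ^ 2)) by lra; reflexivity. }
split; [exact HT|]; intros t; split.
- rewrite Hinc by lra; exact HwT.
- intros u Hu; rewrite Hinc, <- HwT by lra.
  apply Rmult_lt_compat_l; lra.
Qed.

Theorem theorem4p2 (A s c : R) (hA : 0 < A < 1 / 3) (hs : 2 < s)
  (hc : Rabs c = abs_c_star A s) :
  (forall theta0 : R,
     exists g : R -> phase_point,
       (is_circular_orbit A g /\ has_s_and_p_theta A g s c /\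
        q_theta (g 0) = theta0) /\
       (forall g' : R -> phase_point,
          is_circular_orbit A g' -> has_s_and_p_theta A g' s c ->
          q_theta (g' 0) = theta0 ->
          forall t : R, g' t = g t)) /\
  (forall g : R -> phase_point,
     is_circular_orbit A g -> has_s_and_p_theta A g s c ->
     has_radius g (r_star A s) /\
     is_period g (2 * PI * r_star A s ^ 2 / Rabs c)).
Proof.
split.
- intros theta0; exists (circular_flow A s c theta0); split; [split; [|split]|].
  + now apply circular_flow_is_circular_orbit.
  + intros t; split; [|reflexivity].
    exact (proj1 (circular_flow_s_d A s hA hs)).
  + simpl; ring.
  + intros g' Hg' Hsc <-; now apply circular_orbit_eq_flow.
- intros g Hg Hsc.
  (* Any such orbit is the explicit flow started at its own initial angle, so radius and period
     transfer from there. *)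
  pose proof (circular_orbit_eq_flow A s c g hA hs Hg Hsc) as E.
  split.
  + intros t; rewrite E; reflexivity.
  + assert (Hc : c <> 0)
      by (rewrite <- (proj2 (Hsc 0)); apply (proj2 (proj2 (proj2 Hg)))).
    destruct (circular_flow_is_period A s c (q_theta (g 0))
                (r_star_pos A s hA hs) Hc) as [HT HP].
    split; [exact HT|]; intros t; destruct (HP t) as [H1 H2].
    split; [rewrite (E (t + _)), (E t); exact H1|].
    intros u Hu; rewrite (E (t + u)), (E t); exact (H2 u Hu).
Qed.
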